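(* There exists an absolute constant $C>0$ such that for every $n\in\mathbb N$, every convex body $K\subseteq\mathbb R^n$ with $0\in K$ and every $N\in\mathbb N$ with $N\geq3$, $$\int_{O(n)}\frac{1}{(G_n(UK))^N}\sum_{x_1,\ldots,x_N\in UK\cap\mathbb Z^n}\max_{1\leq i\leq N}|\langle x_i,e_n\rangle|\,d\nu(U)\leq C\int_{O(n)}\left(\frac{1}{G_n(UK)}\sum_{x\in UK\cap\mathbb Z^n}|\langle x,e_n\rangle|^{\log N}\right)^{\frac{1}{\log N}}d\nu(U).$$
   Context: A convex body is a compact convex subset of $\mathbb R^n$ with non-empty interior. $(e_i)_{i=1}^n$ is the canonical basis of $\mathbb R^n$. For a bounded set $L\subseteq\mathbb R^n$, $G_n(L)$ is the cardinality of $L\cap\mathbb Z^n$. $O(n)$ is the group of orthogonal $n\times n$ matrices and $\nu$ is its Haar probability measure. The sum on the left-hand side runs over all $N$-tuples $(x_1,\dots,x_N)\in(UK\cap\mathbb Z^n)^N$. $\log$ is the natural logarithm. An absolute constant is a number independent of all parameters ($n$, $K$, $N$). *)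

(* Defs.v *)
From HB Require Import structures.
From mathcomp Require Import all_boot all_order all_algebra finmap.
From mathcomp Require Import all_classical all_reals all_analysis.

Set Implicit Arguments.
Unset Strict Implicit.
Unset Printing Implicit Defensive.

Import Order.TTheory GRing.Theory Num.Theory.
Import numFieldNormedType.Exports.

Local Open Scope classical_set_scope.
Local Open Scope ring_scope.

Definition convex_body (R : realType) (n : nat) (K : set 'cV[R]_n) : Prop :=
  [/\ compact K, convex_set K & K° !=set0].

Definition inner (R : realType) (n : nat) (x y : 'cV[R]_n) : R :=
  \sum_(i < n) x i 0 * y i 0.

Definition basis_vector (R : realType) (n : nat) (i : 'I_n) : 'cV[R]_n :=
  delta_mx i 0.

Definition integer_points (R : realType) (n : nat) : set 'cV[R]_n :=
  [set x | forall i, x i 0 \is a Num.int].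
Arguments integer_points R n : clear implicits.

(* The number of integer points of L. Since fset_set sends infinite sets to the
   empty finite set, this is only meaningful for bounded L. *)
Definition lattice_count (R : realType) (n : nat) (L : set 'cV[R]_n) : nat :=
  #|` fset_set (L `&` integer_points R n)|.

Definition tuples_in (T : Type) (N : nat) (A : set T) : set (N.-tuple T) :=
  [set x | forall i, A (tnth x i)].
Arguments tuples_in {T} N A.

Definition orthogonal_matrices (R : realType) (n : nat) : set 'M[R]_n :=
  [set U | U^T *m U = 1%:M].
Arguments orthogonal_matrices R n : clear implicits.

(* O(n), with the topology induced by that of the n x n matrices. *)
Definition orthogonal_group (R : realType) (n : nat) : Type :=
  set_type (orthogonal_matrices R n).

HB.instance Definition _ (R : realType) (n : nat) :=
  Topological.copy (orthogonal_group R n)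
    (set_type (orthogonal_matrices R n)).

Section OrthogonalGroup.
Context (R : realType) (n : nat).
Implicit Types U V : orthogonal_group R n.

Definition orth_mx U : 'M[R]_n := set_val U.

Lemma orth_mxP U : (orth_mx U)^T *m orth_mx U = 1%:M.
Proof. exact: (set_mem (valP U)). Qed.

Lemma orth_one_subproof : (1%:M : 'M[R]_n) \in orthogonal_matrices R n.
Proof. by apply/mem_set; rewrite /orthogonal_matrices /= trmx1 mulmx1. Qed.

Definition orth_one : orthogonal_group R n :=
  exist (fun M => M \in orthogonal_matrices R n) _ orth_one_subproof.

Lemma orth_mul_subproof U V :
  orth_mx U *m orth_mx V \in orthogonal_matrices R n.
Proof.
apply/mem_set; rewrite /orthogonal_matrices /= trmx_mul mulmxA.
by rewrite -(mulmxA _ (orth_mx U)^T) orth_mxP mulmx1 orth_mxP.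
Qed.

Definition orth_mul U V : orthogonal_group R n :=
  exist (fun M => M \in orthogonal_matrices R n) _
    (orth_mul_subproof U V).

HB.instance Definition _ := isPointed.Build (orthogonal_group R n) orth_one.

Definition orth_image U (K : set 'cV[R]_n) : set 'cV[R]_n :=
  [set orth_mx U *m x | x in K].

End OrthogonalGroup.

Definition borel_orthogonal (R : realType) (n : nat) : Type :=
  g_sigma_algebraType (@open (orthogonal_group R n)).

HB.instance Definition _ (R : realType) (n : nat) :=
  Measurable.copy (borel_orthogonal R n)
    (g_sigma_algebraType (@open (orthogonal_group R n))).

(* As O(n) is a compact group, exactly one Borel probability measure on it is
   invariant under left translations: its Haar probability measure. *)
Definition is_haar_probability (R : realType) (n : nat)
    (nu : probability (borel_orthogonal R n) R) : Prop :=
  forall (V : orthogonal_group R n) (A : set (borel_orthogonal R n)),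
    measurable A -> nu (orth_mul V @` A) = nu A.

(* Main.v *)
(* The inequality holds for every U separately. With p = log N, S the set
   U K \cap Z^n, f = |<., e_n>| and m the mean of f^p over S, every lam > 0
   satisfies max_i t_i <= lam + lam^(1-p) sum_i t_i^p. Averaging over S^N bounds
   the mean of the maximum by lam + lam^(1-p) N m, which is at most 2 lam as soon
   as lam >= (N m)^(1/p) = e m^(1/p). The integral of a nonnegative function is a
   supremum over simple functions below it, so monotonicity and scaling need no
   measurability of the integrands. *)

Require Import Defs.
From mathcomp Require Import all_boot all_order all_algebra finmap.
From mathcomp Require Import all_classical all_reals all_analysis.
From mathcomp Require Import ring lra.

Import Order.TTheory GRing.Theory Num.Theory.
Import numFieldNormedType.Exports.

Local Open Scope classical_set_scope.
Local Open Scope ring_scope.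

(** Since [exp(-1/6) >= 5/6], the sixth power gives [e <= (6/5)^6 < 3]. This ensures [log N >= 1]
    for [N >= 3]. *)
Lemma expR1_le3 (R : realType) : expR 1 <= 3 :> R.
Proof.
have h : (5 / 6 : R) <= expR (- 6^-1).
  by apply: le_trans (expR_ge1Dx _); lra.
have : (5 / 6 : R) ^+ 6 <= expR (- 1).
  have -> : - 1 = 6%:R * - 6^-1 :> R by field.
  rewrite expRM_natl; apply: lerXn2r => //; rewrite nnegrE.
    lra.
  exact: expR_ge0.
rewrite expRN => h6.
have e0 : 0 < expR 1 :> R by exact: expR_gt0.
have : (5 / 6 : R) ^+ 6 * expR 1 <= 1 by rewrite -ler_pdivlMr// div1r.
lra.
Qed.

(** If [t > lam], the ratio [t / lam] is at least 1, hence at most its [p]-th power. *)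
Lemma le_add_scaled_powR (R : realType) (lam p t : R) :
  0 < lam -> 1 <= p -> 0 <= t -> t <= lam + lam * (t `^ p / lam `^ p).
Proof.
move=> lam0 p1 t0; have [tlam|/ltW lamt] := leP t lam.
  rewrite (le_trans tlam)// lerDl; apply: mulr_ge0; first exact: ltW.
  by rewrite divr_ge0// powR_ge0.
have h : 1 <= t / lam by rewrite ler_pdivlMr// mul1r.
have tE : t `^ p = (t / lam) `^ p * lam `^ p.
  by rewrite -powRM ?divr_ge0 ?divfK// ?gt_eqF// ltW.
rewrite tE mulfK ?gt_eqF ?powR_gt0//.
have := le1r_powR h p1; rewrite ler_pdivrMr// [_ * lam]mulrC => /le_trans; apply.
by rewrite lerDr ltW.
Qed.

Lemma sum_ffun_coord (R : comNzRingType) (T : finType) (N : nat) (i : 'I_N.+1)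
    (g : T -> R) :
  \sum_(x : {ffun 'I_N.+1 -> T}) g (x i) = #|T|%:R ^+ N * \sum_t g t.
Proof.
(* With [g] at coordinate [i] and 1 elsewhere, the sum factors over the coordinates; each of the [N]
   others contributes [#|T|]. *)
pose F (k : 'I_N.+1) t := if k == i then g t else 1.
transitivity (\sum_(x : {ffun 'I_N.+1 -> T}) \prod_k F k (x k)).
  apply: eq_bigr => x _; rewrite (bigD1 i)//= big1 /F ?eqxx ?mulr1// => k.
  by move/negbTE->.
rewrite -bigA_distr_bigA (bigD1 i)//= mulrC; congr (_ * _); last first.
  by apply: eq_bigr => t _; rewrite /F eqxx.
transitivity (\prod_(k < N.+1 | k != i) (#|T|%:R : R)).
  by apply: eq_bigr => k /negbTE ki; rewrite /F ki sumr_const.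
by rewrite prodr_const cardC1 card_ord.
Qed.

Lemma sum_max_le (R : realType) (T : finType) (N : nat) (f : T -> R)
    (p lam : R) :
  (forall t, 0 <= f t) -> 1 <= p -> 0 < lam ->
  N.+1%:R * \sum_t f t `^ p <= #|T|%:R * lam `^ p ->
  \sum_(x : {ffun 'I_N.+1 -> T}) \big[Num.max/0]_i f (x i)
    <= 2 * lam * #|T|%:R ^+ N.+1.
Proof.
move=> f0 p1 lam0 hlam.
have lamp0 : 0 < lam `^ p by exact: powR_gt0.
apply: (@le_trans _ _ (\sum_(x : {ffun 'I_N.+1 -> T})
    (lam + lam * (\sum_i f (x i) `^ p / lam `^ p)))).
  apply: ler_sum => x _; apply: bigmax_le => [|i _].
    rewrite addr_ge0 ?mulr_ge0 ?sumr_ge0// ?ltW// => i _.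
    by rewrite divr_ge0// powR_ge0.
  apply: (le_trans (le_add_scaled_powR _ lam p (f (x i)) lam0 p1 (f0 _))).
  rewrite lerD2l ler_pM2l// (bigD1 i)//= lerDl sumr_ge0// => j _.
  by rewrite divr_ge0// powR_ge0.
rewrite big_split/= sumr_const -mulr_sumr exchange_big/=.
under eq_bigr do rewrite (sum_ffun_coord _ _ _ _ (fun t => f t `^ p / lam `^ p)).
rewrite sumr_const card_ord card_ffun card_ord -mulr_suml.
rewrite -(mulr_natl lam) natrX -(mulr_natl (_ * _)).
(* By [hlam], the power terms contribute at most as much as the constant term [lam], whence the
   factor 2. *)
have : N.+1%:R * (#|T|%:R ^+ N * (\sum_t f t `^ p / lam `^ p)) <=
    #|T|%:R ^+ N.+1 :> R.
  rewrite mulrCA exprSr ler_wpM2l ?exprn_ge0//.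
  by rewrite -mulr_suml mulrA ler_pdivrMr.
rewrite -mulr_suml.
by move/(ler_wpM2l (ltW lam0)); lra.
Qed.

Lemma mean_max_le (R : realType) (T : finType) (N : nat) (f : T -> R) :
  (forall t, 0 <= f t) -> (3 <= N)%N -> (0 < #|T|)%N ->
  (#|T|%:R ^+ N)^-1 *
    \sum_(x : {ffun 'I_N -> T}) \big[Num.max/0]_i f (x i) <=
  2 * expR 1 *
    (#|T|%:R^-1 * \sum_t f t `^ ln N%:R) `^ (ln N%:R)^-1.
Proof.
case: N => // N f0 N3 T0.
set p := ln _; set m := (X in _ <= _ * X `^ _).
have NE : expR p = N.+1%:R by rewrite lnK// posrE ltr0n.
have p1 : 1 <= p.
  by rewrite -ler_expR NE (le_trans (expR1_le3 R))// ler_nat.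
have p0 : 0 < p by exact: lt_le_trans p1.
have T0' : 0 < #|T|%:R :> R by rewrite ltr0n.
have m0 : 0 <= m.
  by rewrite mulr_ge0 ?invr_ge0 ?sumr_ge0// => t _; exact: powR_ge0.
(* The natural choice [lam = e m^(1/p)] vanishes when [m = 0]; an arbitrarily small slack keeps
   [lam] positive. *)
rewrite -mulrA -ler_pdivrMl//; apply/ler_addgt0Pr => e e0.
set M := (X in _ <= X + e); set lam := M + e.
have hlam : M < lam by rewrite ltrDl.
have lam0 : 0 < lam.
  by apply: le_lt_trans hlam; rewrite mulr_ge0 ?powR_ge0 ?expR_ge0.
rewrite ler_pdivrMl// ler_pdivrMl ?exprn_gt0// mulrC.
apply: (@sum_max_le _ _ _ _ p) => //.
suff : N.+1%:R * m <= lam `^ p.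
  by rewrite -(ler_pM2l T0') mulrCA mulVKf ?gt_eqF.
rewrite (le_trans _ (ge0_ler_powR (ltW p0) _ _ (ltW hlam)))//; last 2 first.
- by rewrite nnegrE mulr_ge0 ?powR_ge0 ?expR_ge0.
- by rewrite nnegrE ltW.
(* The [p]-th power of [e m^(1/p)] is [e^p m], and [e^p = N.+1] because [p] is its logarithm. *)
rewrite powRM ?powR_ge0 ?expR_ge0// -powRrM mulVf ?gt_eqF// powRr1//.
by rewrite -expRM mul1r NE.
Qed.

(* For infinite S the left-hand side is 0, because fset_set S is
   then empty and 0^-1 = 0. *)
Lemma mean_max_tuples_le (R : realType) (V : choiceType) (S : set V)
    (f : V -> R) (N : nat) :
  (forall x, 0 <= f x) -> (3 <= N)%N ->
  ((#|` fset_set S|)%:R ^+ N)^-1 *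
    \sum_(x \in tuples_in N S) \big[Num.max/0]_(i < N) f (tnth x i) <=
  2 * expR 1 *
    ((#|` fset_set S|)%:R^-1 * \sum_(x \in S) f x `^ ln N%:R)
    `^ (ln N%:R)^-1.
Proof.
move=> f0 N3; have [S0|] := posnP #|` fset_set S|.
  (* This covers empty [S] as well; [0 ^+ N] is 0 because [N] is positive. *)
  rewrite S0 expr0n gtn_eqF ?invr0 ?mul0r; last exact: leq_trans N3.
  by rewrite mulr_ge0 ?powR_ge0// mulr_ge0// expR_ge0.
have [Sfin|Sinf] := pselect (finite_set S); last first.
  by rewrite /fset_set; case: pselect => // _; rewrite cardfs0.
rewrite (@fsbig_finite _ _ _ _ S)//; have := fset_setK Sfin.
move: (fset_set S) => A SA; rewrite cardfE => A0.
have -> : \sum_(x \in tuples_in N S) \big[Num.max/0]_(i < N) f (tnth x i) =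
    \sum_(x : {ffun 'I_N -> A}) \big[Num.max/0]_i f (val (x i)).
  (* A bijection from functions into the finite type [A] onto the tuples in [S]. *)
  pose h (x : {ffun 'I_N -> A}) := [tuple val (x i) | i < N].
  rewrite (reindex_fsbig h setT); last first.
    split.
    - by move=> x _ i /=; rewrite tnth_mktuple -SA /=; exact: valP.
    - move=> x y _ _ /(congr1 (@tnth _ _)) xy; apply/ffunP => i; apply/val_inj.
      by have := congr1 (fun g => g i) xy; rewrite /= !tnth_mktuple.
    - move=> y /= yS; have yA i : tnth y i \in A by have := yS i; rewrite -SA.
      exists [ffun i => FSetSub (yA i)] => //; apply: eq_from_tnth => i.
      by rewrite tnth_mktuple ffunE.
  have -> : [set: {ffun 'I_N -> A}] = [set` predT] by apply/seteqP; split.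
  rewrite -(@bigfs _ _ _ _ (index_enum _)) ?index_enum_uniq//.
    by apply: eq_bigr => x _; apply: eq_bigr => i _; rewrite tnth_mktuple.
  by move=> i _; rewrite mem_index_enum.
rewrite big_seq_fsetE; exact: mean_max_le.
Qed.

(** If a simple function [h] lies below [f], then [c^-1 h] is a simple function below [g]; take
    suprema. *)
Lemma ge0_le_integral_scale d (T : measurableType d) (R : realType)
    (mu : {measure set T -> \bar R}) (f g : T -> R) (c : R) :
  0 < c -> (forall x, 0 <= f x) -> (forall x, 0 <= g x) ->
  (forall x, f x <= c * g x) ->
  (\int[mu]_x (f x)%:E <= c%:E * \int[mu]_x (g x)%:E)%E.
Proof.
move=> c0 f0 g0 fg; rewrite !ge0_integralTE; last 2 first.
- by move=> x; rewrite lee_fin.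
- by move=> x; rewrite lee_fin.
apply: ge_ereal_sup => _ [h /= hf <-].
have ci0 : 0 <= c^-1 by rewrite invr_ge0 ltW.
rewrite -lee_pdivrMl// -sintegralrM; apply: ereal_sup_ubound.
exists (scale_nnsfun h ci0) => //= x.
by rewrite lee_fin ler_pdivrMl// (le_trans _ (fg x))// -lee_fin.
Qed.

(* The dimension is n.+1, and e_n is the last basis vector, of index ord_max.
   The maximum starts at 0, which is harmless for nonnegative terms. *)
Theorem theorem1p3 (R : realType) :
  exists2 C : R, 0 < C &
    forall (n : nat) (K : set 'cV[R]_n.+1) (N : nat)
      (nu : probability (borel_orthogonal R n.+1) R),
      convex_body K -> K 0 -> (3 <= N)%N -> is_haar_probability nu ->
      (\int[nu]_U
         (((lattice_count (orth_image U K))%:R ^+ N)^-1 *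
          \sum_(x \in tuples_in N (orth_image U K `&` integer_points R n.+1))
            \big[Num.max/0]_(i < N)
              `|inner (tnth x i) (basis_vector R ord_max)|)%R%:E
       <= C%:E *
       \int[nu]_U
         (((lattice_count (orth_image U K))%:R^-1 *
           \sum_(x \in orth_image U K `&` integer_points R n.+1)
             `|inner x (basis_vector R ord_max)| `^ ln N%:R)
          `^ (ln N%:R)^-1)%R%:E)%E.

Proof.
(* The factor [e] is [N^(1/log N)]; the 2 counts the two equal bounds in the truncation at [lam]. *)
exists (2 * expR 1) => [|n K N nu _ _ N3 _]; first by rewrite mulr_gt0// expR_gt0.
apply: ge0_le_integral_scale => [|U|U|U].
- by rewrite mulr_gt0// expR_gt0.
- rewrite mulr_ge0 ?invr_ge0 ?exprn_ge0//.
  by apply: fsumr_ge0 => x _; exact: bigmax_ge_id.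
- exact: powR_ge0.
- exact: mean_max_tuples_le.
Qed.
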